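(* Assume (A1) (convexity, compactness, bounded subgradients) and (A2) (network assumption), and let the step size be $c(k)=\frac{\theta}{\sqrt{k+1}}$, $k\ge 0$, for some $\theta>0$. Let $(x_i(k))_{k\ge 0}$, $i=1,\dots,m$, be sequences generated by the subgradient averaging algorithm from arbitrary $x_i(0)\in X_i$, and let $(\hat x_i(k))_{k\ge0}$ be the associated running averages. Let $x^\star$ be a minimizer of $f=\sum_{i=1}^m f_i$ over $\bigcap_{i=1}^m X_i$. Then: (i) for all $i,j=1,\dots,m$, the sequence $\|\hat x_i(k)-\hat x_j(k)\|_2$ converges to zero at rate $\mathcal{O}\!\left(\frac{\ln k}{\sqrt{k}}\right)$ as $k\to\infty$; (ii) for each $i=1,\dots,m$, all accumulation points of $(\hat x_i(k))_{k}$ are feasible, i.e. belong to $\bigcap_{i=1}^m X_i$; (iii) there exist constants $B_1,B_2>0$ such that, for all $k\ge 1$, $$\left|\sum_{i=1}^m f_i(\hat x_i(k))-f(x^\star)\right|\le B_1\frac{1}{\sqrt{k}}+B_2\frac{\ln k}{\sqrt{k}}.$$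
   Context: Problem: minimise $f(x)=\sum_{i=1}^m f_i(x)$ subject to $x\in\bigcap_{i=1}^m X_i$, with $f_i:\mathbb{R}^n\to\mathbb{R}$ and $X_i\subset\mathbb{R}^n$, $i=1,\dots,m$. (A1): (i) each $f_i$ is convex; (ii) each $X_i$ is compact and convex, and $\bigcap_{i=1}^m X_i$ has non-empty interior; (iii) $L=\max\{\|\xi\|_2:\ \xi\in\partial f(x),\ x\in\bigcup_{i=1}^m X_i\}<\infty$, where $\partial f(x)$ is the convex subdifferential. Network: for each $k\ge 0$, $\mathcal{G}(k)=(\mathcal{N},\mathcal{E}(k))$ is an undirected graph on $\mathcal{N}=\{1,\dots,m\}$ (so $(j,i)\in\mathcal{E}(k)$ iff $(i,j)\in\mathcal{E}(k)$), and $A(k)\in\mathbb{R}^{m\times m}$ is a matrix whose entry in row $j$, column $i$ is denoted $[A(k)]_j^i$; for $j\neq i$, $[A(k)]_j^i>0$ if and only if $(j,i)\in\mathcal{E}(k)$. Let $\mathcal{E}_\infty$ be the set of pairs $(j,i)$ such that $(j,i)\in\mathcal{E}(k)$ for infinitely many $k$. (A2): (i) the graph $(\mathcal{N},\mathcal{E}_\infty)$ is strongly connected, and there is a uniform bound on the intercommunication time: there exists an integer $T\ge 1$ such that for every $(j,i)\in\mathcal{E}_\infty$ and every $k\ge 0$, $(j,i)\in\mathcal{E}(k)\cup\mathcal{E}(k+1)\cup\dots\cup\mathcal{E}(k+T-1)$; (ii) there exists $\eta\in(0,1)$ such that for all $k\ge0$ and all $i,j$, $[A(k)]_i^i\ge\eta$,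 and $[A(k)]_j^i>0$ implies $[A(k)]_j^i\ge\eta$; (iii) each $A(k)$ is doubly stochastic (non-negative entries, all rows and columns summing to one). Subgradient averaging algorithm: given $x_i(0)\in X_i$ for $i=1,\dots,m$, for $k=0,1,2,\dots$ and every $i$: 1. $z_i(k)=\sum_{j=1}^m [A(k)]_j^i\,x_j(k)$; 2. pick any $g_i(z_i(k))\in\partial f_i(z_i(k))$; 3. $d_i(k)=\sum_{j=1}^m [A(k)]_j^i\,g_j(z_j(k))$; 4. $x_i(k+1)=\operatorname{argmin}_{\xi\in X_i}\ d_i(k)^T\xi+\frac{1}{2c(k)}\|z_i(k)-\xi\|_2^2$ (equivalently, the Euclidean projection of $z_i(k)-c(k)d_i(k)$ onto $X_i$). Running averages: let $S(k)=\sum_{r=1}^k c(r)$ (so $S(0)=0$), $\hat x_i(0)=x_i(0)$ and $$\hat x_i(k+1)=\frac{c(k+1)\,x_i(k+1)+S(k)\,\hat x_i(k)}{S(k+1)},\quad k\ge 0,$$ i.e. $\hat x_i(k)=\frac{1}{S(k)}\sum_{r=1}^k c(r)x_i(r)$ for $k\ge 1$. *)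

(* Defs.v *)
From HB Require Import structures.
From mathcomp Require Export all_boot all_order all_algebra.
From mathcomp Require Export all_classical all_reals all_analysis.

Set Implicit Arguments.
Unset Strict Implicit.
Unset Printing Implicit Defensive.

Export Order.TTheory GRing.Theory Num.Theory.
Export numFieldNormedType.Exports.

Local Open Scope classical_set_scope.
Local Open Scope ring_scope.

(* Points of R^n are row vectors. The library norm on 'rV[R]_n is the sup norm,
   so the Euclidean norm is defined here. The two norms are equivalent, so
   [compact], interior and [cluster] keep their usual meaning. *)
Section Euclidean.
Context {R : realType} {n : nat}.
Implicit Types (u v x g : 'rV[R]_n) (f : 'rV[R]_n -> R) (D : set 'rV[R]_n).

Definition dotv u v : R := \sum_(l < n) u ord0 l * v ord0 l.

Definition norm2 u : R := Num.sqrt (dotv u u).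

Definition subdifferential f x : set 'rV[R]_n :=
  [set g | forall y, f x + dotv g (y - x) <= f y].

Definition is_argmin D f x := D x /\ forall y, D y -> f x <= f y.

Definition is_max (S : set R) (L : R) := S L /\ ubound S L.

End Euclidean.

Section Problem.
Context {R : realType} {m n : nat}.
Variables (f : 'I_m -> 'rV[R]_n -> R) (X : 'I_m -> set 'rV[R]_n).

Definition objective (x : 'rV[R]_n) : R := \sum_(i < m) f i x.

Definition feasible : set 'rV[R]_n := \bigcap_(i in [set: 'I_m]) X i.

(* [subgradients_bounded] forces 0 < m, as the maximum is attained. *)
Record convex_problem : Prop := {
  cost_convex : forall i,
    convex_function ([set: 'rV[R]_n] : set (convex_lmodType 'rV[R]_n)) (f i);
  constraint_compact : forall i, compact (X i);
  constraint_convex : forall i,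
    convex_set (X i : set (convex_lmodType 'rV[R]_n));
  feasible_interior : feasible° !=set0;
  subgradients_bounded : exists L : R,
    is_max [set r | exists x g, [/\ (\bigcup_(i in [set: 'I_m]) X i) x,
                                    subdifferential objective x g
                                  & r = norm2 g]] L
}.

End Problem.

(* The weight written [A(k)]_j^i (row j, column i) is [A k j i]. *)
Section Network.
Context {R : realType} {m : nat}.
Variables (E : nat -> rel 'I_m) (A : nat -> 'M[R]_m).

Definition edge_infty (j i : 'I_m) : Prop :=
  forall K : nat, exists2 k, (K <= k)%N & E k j i.

Definition strongly_connected (e : 'I_m -> 'I_m -> Prop) : Prop :=
  forall j i, connect [rel a b | `[< e a b >]] j i.

Definition doubly_stochastic (M : 'M[R]_m) : Prop :=
  [/\ forall j i, 0 <= M j i,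
      forall j, \sum_(i < m) M j i = 1
    & forall i, \sum_(j < m) M j i = 1].

Definition weighted_graphs : Prop :=
  (forall k, symmetric (E k)) /\
  (forall k j i, j != i -> (0 < A k j i <-> E k j i)).

Record network_assumption : Prop := {
  network_connected : strongly_connected edge_infty;
  network_intercommunication : exists2 T : nat, (1 <= T)%N &
    forall j i, edge_infty j i -> forall k, exists2 t, (t < T)%N & E (k + t) j i;
  network_weights : exists eta : R, [/\ 0 < eta, eta < 1 &
    forall k i j, eta <= A k i i /\ (0 < A k j i -> eta <= A k j i)];
  network_stochastic : forall k, doubly_stochastic (A k)
}.

End Network.

Section Algorithm.
Context {R : realType} {m n : nat}.
Variables (c : nat -> R) (f : 'I_m -> 'rV[R]_n -> R) (X : 'I_m -> set 'rV[R]_n)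
  (A : nat -> 'M[R]_m).

Definition mix (u : 'I_m -> nat -> 'rV[R]_n) (i : 'I_m) (k : nat) : 'rV[R]_n :=
  \sum_(j < m) A k j i *: u j k.

(* [g i k] is the subgradient of [f i] picked at z_i(k) = [mix x i k]; the pick
   may differ at two iterations with the same z_i. The direction d_i(k) is
   [mix g i k]. *)
Record subgradient_averaging (x g : 'I_m -> nat -> 'rV[R]_n) : Prop := {
  iterate0 : forall i, X i (x i 0%N);
  subgradient_pick : forall i k, subdifferential (f i) (mix x i k) (g i k);
  iterateS : forall i k,
    is_argmin (X i)
      (fun xi => dotv (mix g i k) xi
                 + (2 * c k)^-1 * norm2 (mix x i k - xi) ^+ 2)
      (x i k.+1)
}.

Definition step_sum (k : nat) : R := \sum_(1 <= r < k.+1) c r.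

Fixpoint running_average (u : nat -> 'rV[R]_n) (k : nat) : 'rV[R]_n :=
  if k is k'.+1 then
    (step_sum k'.+1)^-1 *:
      (c k'.+1 *: u k'.+1 + step_sum k' *: running_average u k')
  else u 0%N.

End Algorithm.

Definition sqrt_step {R : realType} (theta : R) (k : nat) : R :=
  theta / Num.sqrt k.+1%:R.

(* Main.v *)
(* Consensus. Over a window of m * T steps the product of the weight matrices has
   all entries at least some eps > 0, so the diameter of {x_1(k), ..., x_m(k)}
   contracts by the factor 1 - eps^2, up to the errors |x_i(k+1) - z_i(k)|. Since
   c is nonincreasing, the sum of c(k) diam(k) is at most a constant plus a
   multiple of P = the sum of c(k) sum_i |x_i(k+1) - z_i(k)|.

   Optimality. The proximal inequality at xstar telescopes. The iterates are not
   feasible for the whole intersection, but they are at distance O(diam(k)) from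
   it because it has an interior point, so the optimality gap is at least
   - O(diam(k)). Hence the sum of the squared errors is O(1 + P), while
   2 a c e <= e^2 + a^2 c^2 bounds P by a small multiple of the squared errors plus
   a multiple of sum c^2. So all three sums, and the weighted sum of the gaps, are
   O(1 + sum c^2). Convexity transfers this to the running averages after a
   division by S(k); for c(k) = theta / sqrt(k+1) the sum of c^2 is O(1 + ln k)
   and S(k) is at least theta sqrt(k) / 2.

   Estimates on vectors use the library's sup norm, except that the proximal
   inequality is stated with [dotv]. *)
From mathcomp Require Import lra ring zify.
Require Import Defs.

Set Implicit Arguments.
Unset Strict Implicit.
Unset Printing Implicit Defensive.

Local Open Scope classical_set_scope.
Local Open Scope ring_scope.

(** * Euclidean space and convexity *)

Section EuclideanFacts.
Context {R : realType} {n : nat}.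
Implicit Types (u v w : 'rV[R]_n) (a : R).

Lemma dotvC u v : dotv u v = dotv v u.
Proof. by apply: eq_bigr => l _; rewrite mulrC. Qed.

Lemma dotvDl u v w : dotv (u + v) w = dotv u w + dotv v w.
Proof. by rewrite -big_split; apply: eq_bigr => l _; rewrite mxE mulrDl. Qed.

Lemma dotvZl a u v : dotv (a *: u) v = a * dotv u v.
Proof. by rewrite mulr_sumr; apply: eq_bigr => l _; rewrite mxE mulrA. Qed.

Lemma dotvDr u v w : dotv u (v + w) = dotv u v + dotv u w.
Proof. by rewrite !(dotvC u) dotvDl. Qed.

Lemma dotvZr a u v : dotv u (a *: v) = a * dotv u v.
Proof. by rewrite !(dotvC u) dotvZl. Qed.

Lemma dotvNl u v : dotv (- u) v = - dotv u v.
Proof. by rewrite -scaleN1r dotvZl mulN1r. Qed.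

Lemma dotvNr u v : dotv u (- v) = - dotv u v.
Proof. by rewrite !(dotvC u) dotvNl. Qed.

Lemma dotv_suml (I : finType) (F : I -> 'rV[R]_n) v :
  dotv (\sum_i F i) v = \sum_i dotv (F i) v.
Proof.
rewrite /dotv exchange_big /=; apply: eq_bigr => l _.
by rewrite summxE mulr_suml.
Qed.

Lemma dotv_ge0 u : 0 <= dotv u u.
Proof. by apply: sumr_ge0 => l _; rewrite -expr2 sqr_ge0. Qed.

Lemma norm2_sqr u : norm2 u ^+ 2 = dotv u u.
Proof. by rewrite sqr_sqrtr // dotv_ge0. Qed.

Lemma coord_le_norm u l : `|u ord0 l| <= `|u|.
Proof.
by rewrite [leRHS]/Num.Def.normr /= mx_normrE; apply: (le_bigmax _ _ (ord0, l)).
Qed.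

Lemma norm_le_coord u a : 0 <= a -> (forall l, `|u ord0 l| <= a) -> `|u| <= a.
Proof.
move=> a0 ua; rewrite [leLHS]/Num.Def.normr /= mx_normrE.
by apply: bigmax_le => // -[i j] _ /=; rewrite (ord1 i).
Qed.

Lemma sqr_norm_le_dotv u : `|u| ^+ 2 <= dotv u u.
Proof.
rewrite -norm2_sqr lerXn2r ?nnegrE ?sqrtr_ge0 //.
apply: norm_le_coord; first exact: sqrtr_ge0.
move=> l; rewrite -sqrtr_sqr ler_wsqrtr // /dotv (bigD1 l) //= -expr2 lerDl.
by apply: sumr_ge0 => j _; rewrite -expr2 sqr_ge0.
Qed.

Lemma normr_dotv u v : `|dotv u v| <= n%:R * `|u| * `|v|.
Proof.
apply: (le_trans (ler_norm_sum _ _ _)).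
apply: (@le_trans _ _ (\sum_(l < n) `|u| * `|v|)).
  by apply: ler_sum => l _; rewrite normrM ler_pM // coord_le_norm.
by rewrite sumr_const card_ord -[leLHS]mulr_natl mulrA.
Qed.

Lemma norm2_le u : norm2 u <= n%:R * `|u|.
Proof.
have h := normr_dotv u u.
rewrite -(@ler_pXn2r _ 2) ?nnegrE ?sqrtr_ge0 ?mulr_ge0 //.
rewrite norm2_sqr (le_trans (ler_norm _)) // (le_trans h) //.
rewrite exprMn -mulrA -expr2 ler_wpM2r ?sqr_ge0 // -natrX ler_nat.
by case: (n) => // k; rewrite expnS expn1 leq_pmulr.
Qed.

Lemma dotv_polar u v : dotv (u + v) (u + v) = dotv u u + 2 * dotv u v + dotv v v.
Proof. by rewrite !(dotvDl, dotvDr) (dotvC v u); ring. Qed.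

End EuclideanFacts.

Section Convexity.
Context {R : realType} {n : nat}.
Implicit Types (f : 'rV[R]_n -> R) (x y : 'rV[R]_n) (t r : R).

Lemma convex_functionE f t x y :
  convex_function ([set: 'rV[R]_n] : set (convex_lmodType 'rV[R]_n)) f ->
  0 <= t <= 1 -> f (t *: x + (1 - t) *: y) <= t * f x + (1 - t) * f y.
Proof.
move=> cf t01; have ti : Itv.spec (@Itv.num_sem R) (Itv.Real `[0%Z, 1%Z]) t.
  by apply/andP; split; [exact: num_real | rewrite /= in_itv /=].
exact: (cf (Itv.mk ti) x y (in_setT _) (in_setT _)).
Qed.

Lemma convex_setE (D : set 'rV[R]_n) t x y :
  convex_set (D : set (convex_lmodType 'rV[R]_n)) ->
  0 <= t <= 1 -> D x -> D y -> D (t *: x + (1 - t) *: y).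
Proof.
move=> cD t01 Dx Dy.
have ti : Itv.spec (@Itv.num_sem R) (Itv.Real `[0%Z, 1%Z]) t.
  by apply/andP; split; [exact: num_real | rewrite /= in_itv /=].
have := cD x y (Itv.mk ti); rewrite !inE; exact.
Qed.

End Convexity.

(** * Local boundedness and Lipschitz continuity of convex functions *)

Section ConvexBounds.
Context {R : realType} {n : nat} (f : 'rV[R]_n -> R).
Context (cf : convex_function
                ([set: 'rV[R]_n] : set (convex_lmodType 'rV[R]_n)) f).
Implicit Types (x y : 'rV[R]_n) (r : R).

(** In this form a sum can be peeled off one coordinate at a time, at the cost of doubling the
    arguments. *)
Lemma convex_midpoint x y : f (x + y) <= (f (2 *: x) + f (2 *: y)) / 2.
Proof.
have h : 0 <= (2^-1 : R) <= 1 by apply/andP; split; lra.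
have := convex_functionE (2 *: x) (2 *: y) cf h.
rewrite (_ : 1 - 2^-1 = 2^-1 :> R); last by field.
by rewrite !scalerA mulVf // !scale1r; lra.
Qed.

(** The point [a *: x] is a convex combination of [r *: x] and [- r *: x], and both weights are at
    most 1. *)
Lemma convex_segment_bounded x r :
  exists M, forall a, `|a| <= r -> f (a *: x) <= M.
Proof.
exists (`|f (r *: x)| + `|f ((- r) *: x)|) => a ar.
have r0 : 0 <= r by apply: le_trans ar.
have [r00|rN0] := eqVneq r 0.
  have -> : a = r by apply/eqP; rewrite r00 -normr_le0 -r00.
  by rewrite (le_trans (ler_norm _)) // lerDl.
have rp : 0 < r by rewrite lt_neqAle eq_sym rN0.
move: ar; rewrite ler_norml => /andP[ra ar].
pose t := (a + r) / (2 * r).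
have t01 : 0 <= t <= 1.
  apply/andP; split; first by apply: divr_ge0; lra.
  by rewrite ler_pdivrMr ?mulr_gt0 //; lra.
have := convex_functionE (r *: x) (- r *: x) cf t01.
have -> : t *: (r *: x) + (1 - t) *: (- r *: x) = a *: x.
  by rewrite !scalerA -scalerDl; congr (_ *: _); rewrite /t; field.
move=> /le_trans; apply; case/andP: t01 => t0 t1.
apply: lerD.
  apply: (le_trans (y := t * `|f (r *: x)|)).
    by rewrite ler_wpM2l // ler_norm.
  by rewrite ler_piMl.
apply: (le_trans (y := (1 - t) * `|f (- r *: x)|)).
  by rewrite ler_wpM2l ?ler_norm //; lra.
by rewrite ler_piMl //; lra.
Qed.

Lemma convex_ball_ub r : exists M, forall x, `|x| <= r -> f x <= M.
Proof.
(* Induction on the list of coordinates; [r'] is quantified in [H] because each use of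
   [convex_midpoint] doubles the radius. *)
suff H (s : seq 'I_n) r' : exists M, forall a : 'I_n -> R,
    (forall l, `|a l| <= r') ->
    f (\sum_(l <- s) a l *: delta_mx ord0 l) <= M.
  have [M HM] := H (index_enum 'I_n) r; exists M => x xr.
  rewrite [x]row_sum_delta; apply: HM => l.
  exact: le_trans (coord_le_norm _ _) xr.
elim: s r' => [|l s IH] r'.
  by exists (f 0) => a _; rewrite big_nil.
have [M1 H1] := convex_segment_bounded (delta_mx ord0 l) (2 * r').
have [M2 H2] := IH (2 * r').
exists ((M1 + M2) / 2) => a ar.
rewrite big_cons; apply: (le_trans (convex_midpoint _ _)).
rewrite ler_wpM2r // lerD //.
  by rewrite scalerA; apply: H1; rewrite normrM ger0_norm // ler_wpM2l.
rewrite scaler_sumr; under eq_bigr do rewrite scalerA.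
by apply: (H2 (fun l => 2 * a l)) => j; rewrite normrM ger0_norm // ler_wpM2l.
Qed.

(** The lower bound comes from [f 0 <= (f x + f (- x)) / 2], where [f (- x)] is already bounded
    above. *)
Lemma convex_ball_bounded r : exists M, forall x, `|x| <= r -> `|f x| <= M.
Proof.
have [M HM] := convex_ball_ub r; exists (`|M| + 2 * `|f 0|) => x xr.
have h1 := HM _ xr.
have h2 : f (- x) <= M by apply: HM; rewrite normrN.
have h : 0 <= (2^-1 : R) <= 1 by apply/andP; split; lra.
have := convex_functionE x (- x) cf h.
rewrite (_ : 1 - 2^-1 = 2^-1 :> R); last by field.
rewrite -scalerDr subrr scaler0 => h3.
have := ler_norm M; have := ler_norm (f 0); have := ler_norm (- f 0).
rewrite normrN => *; rewrite ler_norml; apply/andP; split; lra.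
Qed.

Lemma convex_ball_lipschitz r : exists2 K, 0 <= K &
  forall x y, `|x| <= r -> `|y| <= r -> `|f x - f y| <= K * `|x - y|.
Proof.
have [M HM] := convex_ball_bounded (r + 1); pose K := 2 * `|M|.
suff H x y : `|x| <= r -> `|y| <= r -> f x - f y <= K * `|x - y|.
  exists K => [|x y xr yr]; first by rewrite mulr_ge0.
  rewrite ler_norml H // andbT lerNl opprB distrC; exact: H.
move=> xr yr; have [->|xy] := eqVneq x y; first by rewrite !subrr normr0 mulr0.
have d0 : 0 < `|x - y| by rewrite normr_gt0 subr_eq0.
set d := `|x - y| in d0 *.
(* Prolong the segment from y to x by a unit length. *)
pose w := x + d^-1 *: (x - y).
have wr : `|w| <= r + 1.
  rewrite (le_trans (ler_normD _ _)) // lerD // normrZ -/d.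
  by rewrite gtr0_norm ?invr_gt0 // mulVf // gt_eqF.
(* [x] is the point of weight [t] between [y] and [w]. Since [t <= d], the increment is at most [d]
   times the bound [K] on the oscillation over the larger ball. *)
pose t := d / (1 + d).
have t0 : 0 <= t by apply: divr_ge0; lra.
have t01 : 0 <= t <= 1.
  by rewrite t0 ler_pdivrMr; lra.
have := convex_functionE w y cf t01.
have -> : t *: w + (1 - t) *: y = x.
  apply/rowP => l; rewrite !mxE /t; field.
  by rewrite !gt_eqF //; lra.
have td : t <= d by rewrite ler_pdivrMr ?ler_peMr //; lra.
have hw : `|f w| <= M by apply: HM.
have hy : `|f y| <= M by apply: HM; lra.
have hwy : f w - f y <= K.
  have := ler_norm M; have := ler_norm (f w); have := ler_norm (- f y).
  by rewrite normrN /K; lra.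
have K0 : 0 <= K by rewrite mulr_ge0.
move=> hx; apply: (@le_trans _ _ (t * (f w - f y))); first lra.
apply: (@le_trans _ _ (t * K)); first exact: ler_wpM2l.
by rewrite mulrC ler_wpM2l.
Qed.

(** Moving from [x] by plus or minus a basis vector in the subgradient inequality bounds each
    coordinate of [g] by the Lipschitz constant on the ball of radius [r + 1]. *)
Lemma subgradient_ball_bounded r : exists2 G, 0 <= G &
  forall x g, `|x| <= r -> subdifferential f x g -> `|g| <= G.
Proof.
have [K K0 HK] := convex_ball_lipschitz (r + 1).
exists K => // x g xr gx; apply: norm_le_coord => // l.
have nd : `|delta_mx ord0 l : 'rV[R]_n| <= 1.
  by apply: norm_le_coord => // j; rewrite mxE normr_nat lern1 leq_b1.
have dg : dotv g (delta_mx ord0 l) = g ord0 l.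
  rewrite /dotv (bigD1 l) //= mxE !eqxx mulr1 big1 ?addr0 // => j jl.
  by rewrite mxE (negbTE jl) andbF mulr0.
have H e : `|e| <= 1 -> dotv g e <= K.
  move=> e1; have := gx (x + e); rewrite addrAC subrr add0r => h.
  have xe : `|x + e| <= r + 1 by rewrite (le_trans (ler_normD _ _)) // lerD.
  have xr1 : `|x| <= r + 1 by lra.
  have := HK (x + e) x xe xr1; rewrite addrAC subrr add0r => h2.
  have := ler_norm (f (x + e) - f x).
  have : K * `|e| <= K by rewrite ler_piMr.
  lra.
rewrite ler_norml -dg H // andbT lerNl -dotvNr H // normrN //.
Qed.

End ConvexBounds.

Lemma ge0_of_affine_ge0 (R : realType) (a b : R) :
  (forall t, 0 < t -> t <= 1 -> 0 <= a + t * b) -> 0 <= a.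
Proof.
move=> H; rewrite leNgt; apply/negP => a0.
have d0 : 0 < `|b| + 1 - a by have := normr_ge0 b; lra.
(* With this [t] one has [t * b <= - a / 2], so [a + t * b] stays negative. The summand [1 - a]
   keeps the denominator positive and [t] at most 1. *)
pose t := - a / (2 * (`|b| + 1 - a)).
have t0 : 0 < t by apply: divr_gt0; lra.
have t1 : t <= 1 by rewrite ler_pdivrMr; have := normr_ge0 b; lra.
have := H t t0 t1.
have : t * b <= - a / 2.
  apply: (le_trans (y := t * (`|b| + 1 - a))).
    by rewrite ler_pM2l //; have := ler_norm b; lra.
  by rewrite /t le_eqVlt; apply/orP; left; apply/eqP; field; rewrite gt_eqF.
lra.
Qed.

(** Comparing [p] with [p + t *: (y - p)] and letting [t] tend to 0 gives a variational inequality
    at [p]; expanding the square of [z - y] around [p] turns it into the stated three-point form. *)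
Lemma proximal_step_le (R : realType) (n : nat) (D : set 'rV[R]_n)
    (c : R) (d z p y : 'rV[R]_n) :
  0 < c -> convex_set (D : set (convex_lmodType 'rV[R]_n)) ->
  is_argmin D
    (fun xi => dotv d xi + (2 * c)^-1 * norm2 (z - xi) ^+ 2) p -> D y ->
  dotv (p - y) (p - y) + dotv (p - z) (p - z) + 2 * c * dotv d (p - y)
    <= dotv (z - y) (z - y).
Proof.
move=> c0 cD [Dp minp] Dy.
suff : 0 <= dotv d (y - p) + c^-1 * dotv (p - z) (y - p).
  move=> /(mulr_ge0 (ltW c0)); rewrite mulrDr mulVKf ?gt_eqF //.
  have -> : z - y = - (p - z) + - (y - p) by rewrite !opprB addrA subrK.
  rewrite (dotv_polar (- (p - z))) -[p - y]opprB !(dotvNl, dotvNr, opprK); lra.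
apply: (@ge0_of_affine_ge0 _ _ ((2 * c)^-1 * dotv (y - p) (y - p))) => t t0 t1.
have t01 : 0 <= t <= 1 by rewrite ltW.
have := minp _ (convex_setE cD t01 Dy Dp).
have -> : t *: y + (1 - t) *: p = p + t *: (y - p).
  by apply/rowP => l; rewrite !mxE; ring.
have -> : z - (p + t *: (y - p)) = - (p - z) + - (t *: (y - p)).
  by apply/rowP => l; rewrite !mxE; ring.
rewrite -[z - p]opprB !norm2_sqr (dotv_polar (- (p - z))).
rewrite !(dotvNl, dotvNr, opprK, dotvZr, dotvZl) (dotvDr d p) dotvZr invfM.
move: (dotv (p - z) (p - z)) (dotv (p - z) (y - p)) (dotv (y - p) (y - p)).
move: (dotv d p) (dotv d (y - p)) => a b q s e h.
have : 0 <= t * (b + c^-1 * s + t * (2^-1 / c * e)) by lra.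
by rewrite pmulr_rge0.
Qed.

(** * Consensus *)

Section TransitionMatrices.
Context {R : realType} {m : nat} (E : nat -> rel 'I_m) (A : nat -> 'M[R]_m).
Context (hG : weighted_graphs E A) (hA : network_assumption E A).

(** The product A(k) ... A(k+s-1). Entry (j, i) is the share of agent j's point at time k in agent
    i's point at time k+s under pure averaging; factors are added on the right because column i
    holds the weights used by agent i. *)
Fixpoint transition (k s : nat) : 'M[R]_m :=
  if s is s'.+1 then transition k s' *m A (k + s') else 1%:M.

Lemma weight_ge0 k j i : 0 <= A k j i.
Proof. by have [] := network_stochastic hA k. Qed.

Lemma transition_ge0 k s j i : 0 <= transition k s j i.
Proof.
elim: s j i => [|s IH] j i /=; first by rewrite mxE ler0n.
by rewrite mxE sumr_ge0 // => l _; rewrite mulr_ge0 ?IH ?weight_ge0.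
Qed.

Lemma transition_column_sum k s i : \sum_j transition k s j i = 1.
Proof.
elim: s i => [|s IH] i /=.
  rewrite (bigD1 i) //= big1 => [|j ji]; first by rewrite mxE eqxx addr0.
  by rewrite mxE (negbTE ji).
under eq_bigr do rewrite mxE.
rewrite exchange_big /=; under eq_bigr do rewrite -mulr_suml IH mul1r.
by have [] := network_stochastic hA (k + s).
Qed.

Section LowerBounds.
Context (eta : R) (eta0 : 0 < eta).
Context (heta : forall k i j, eta <= A k i i /\ (0 < A k j i -> eta <= A k j i)).

Lemma transition_step k s j l i :
  eta ^+ s <= transition k s j l -> eta <= A (k + s) l i ->
  eta ^+ s.+1 <= transition k s.+1 j i.
Proof.
move=> hl hli; rewrite /= mxE (bigD1 l) //= exprSr.
rewrite (le_trans (ler_pM _ _ hl hli)) ?exprn_ge0 ?(ltW eta0) //.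
by rewrite lerDl sumr_ge0 // => l' _; rewrite mulr_ge0 ?transition_ge0 ?weight_ge0.
Qed.

(** Diagonal weights are at least [eta], so mass can wait at [i]. *)
Lemma transition_stay k s t j i :
  eta ^+ s <= transition k s j i -> eta ^+ (s + t) <= transition k (s + t) j i.
Proof.
move=> h; elim: t => [|t IH]; first by rewrite addn0.
by rewrite addnS; apply: transition_step IH _; have [] := heta (k + (s + t)) i i.
Qed.

(** Mass waits at [l] until the edge appears, crosses it, then waits at [i] for the rest of the [T]
    steps. *)
Lemma transition_edge k s T j l i :
  (forall k, exists2 t, (t < T)%N & E (k + t) l i) ->
  eta ^+ s <= transition k s j l -> eta ^+ (s + T) <= transition k (s + T) j i.
Proof.
move=> hT hl; have [t tT Et] := hT (k + s)%N.
have -> : (s + T = (s + t).+1 + (T - t.+1))%N by lia.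
apply: transition_stay; apply: transition_step (transition_stay t hl) _.
rewrite addnA.
(* Weights are tied to edges off the diagonal only, so a loop uses the diagonal bound. *)
have [<-|li] := eqVneq l i; first by have [] := heta (k + s + t) l l.
by have [_] := heta (k + s + t) i l; apply; apply/(proj2 hG).
Qed.

End LowerBounds.

(** A path without repeated vertices has fewer than [m] edges, each taking [T] steps; the remaining
    steps of the window are spent waiting at its end. *)
Lemma transition_lower_bound : exists B eps,
  [/\ 0 < eps, eps <= 1 & forall k j i, eps <= transition k B j i].
Proof.
have [eta [eta0 eta1 heta]] := network_weights hA.
have [T T1 hT] := network_intercommunication hA.
exists (m * T)%N, (eta ^+ (m * T)); split.
- exact: exprn_gt0.
- by rewrite exprn_ile1 ?ltW.
move=> k j i; have := network_connected hA j i.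
case/connectP => p0 /shortenP[p ep up _] ->.
have pm : (size p < m)%N by have := card_uniqP up => /= <-; rewrite -[leqRHS]card_ord max_card.
have -> : (m * T = size p * T + (m - size p) * T)%N by rewrite -mulnDl; congr muln; lia.
apply: (transition_stay eta0 heta).
suff H (s : nat) (l : 'I_m) : eta ^+ s <= transition k s j l ->
    path [rel a b | `[< edge_infty E a b >]] l p ->
    eta ^+ (s + size p * T) <= transition k (s + size p * T) j (last l p).
  have := H 0%N j; rewrite add0n; apply => //.
  by rewrite expr0 mxE eqxx.
elim: p s l {ep up pm} => [|a p IH] s l /= hl; first by rewrite mul0n addn0.
case/andP => /asboolP la pa.
rewrite mulSn addnA; apply: IH pa.
exact: (transition_edge eta0 heta (hT _ _ la)).
Qed.

End TransitionMatrices.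

Section Contraction.
Context {R : realType} {m n : nat}.

Lemma weighted_sum_le (w : 'I_m -> R) (u : 'I_m -> 'rV[R]_n) a :
  (forall j, 0 <= w j) -> \sum_j w j = 1 -> (forall j, `|u j| <= a) ->
  `|\sum_j w j *: u j| <= a.
Proof.
move=> w0 w1 ua; rewrite (le_trans (ler_norm_sum _ _ _)) //.
apply: (@le_trans _ _ (\sum_j w j * a)).
  by apply: ler_sum => j _; rewrite normrZ ger0_norm // ler_wpM2l.
by rewrite -mulr_suml w1 mul1r.
Qed.

Lemma weighted_sumB (w : 'I_m -> R) (u : 'I_m -> 'rV[R]_n) y :
  \sum_j w j = 1 -> \sum_j w j *: u j - y = \sum_j w j *: (u j - y).
Proof.
move=> w1; under [RHS]eq_bigr do rewrite scalerBr.
by rewrite sumrB -scaler_suml w1 scale1r.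
Qed.

(* The two averages share a mass of at least eps at index i, where the
   differences [u j - u j'] vanish. *)
Lemma weighted_sum_contract (w w' : 'I_m -> R) (u : 'I_m -> 'rV[R]_n) eps W i :
  0 <= eps ->
  (forall j, 0 <= w j) -> (forall j, 0 <= w' j) -> eps <= w i -> eps <= w' i ->
  \sum_j w j = 1 -> \sum_j w' j = 1 -> (forall j j', `|u j - u j'| <= W) ->
  `|\sum_j w j *: u j - \sum_j w' j *: u j| <= (1 - eps ^+ 2) * W.
Proof.
move=> e0 w0 w'0 wi w'i w1 w'1 uW.
have W0 : 0 <= W by apply: le_trans (uW i i).
rewrite weighted_sumB // (le_trans (ler_norm_sum _ _ _)) //.
(* The term [j' = j] of the inner average vanishes, which saves [w' j * W]. Only the saving at
   [j = i] is kept, where it is at least [eps * W]. *)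
have b j : `|w j *: (u j - \sum_j' w' j' *: u j')| <= w j * ((1 - (j == i)%:R * eps) * W).
  rewrite normrZ ger0_norm // ler_wpM2l // distrC weighted_sumB //.
  rewrite (le_trans (ler_norm_sum _ _ _)) //.
  apply: (@le_trans _ _ (\sum_j' (w' j' * W - (j' == j)%:R * (w' j * W)))).
    apply: ler_sum => j' _; rewrite normrZ ger0_norm //.
    have [->|_] := eqVneq j' j; first by rewrite subrr normr0 mulr0 mul1r subrr.
    by rewrite mul0r subr0 ler_wpM2l.
  rewrite sumrB -mulr_suml w'1 -mulr_suml.
  rewrite (bigD1 j) //= eqxx big1 ?addr0 => [|j' /negbTE->//].
  rewrite mulrA -mulrBl ler_wpM2r // lerB // mul1r.
  by have [->|_] := eqVneq j i; rewrite ?mul1r ?mul0r.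
apply: (le_trans (ler_sum _ (fun j _ => b j))).
have -> : \sum_j w j * ((1 - (j == i)%:R * eps) * W)
  = \sum_j w j * W - \sum_j (j == i)%:R * (w i * eps * W).
  rewrite -sumrB; apply: eq_bigr => j _.
  by have [->|_] := eqVneq j i; rewrite ?mul1r ?mul0r; ring.
rewrite -!mulr_suml w1 (bigD1 i) //= eqxx big1 ?addr0 => [|j' /negbTE->//].
rewrite !mul1r -[X in X - _]mul1r -mulrBl ler_wpM2r // lerB // expr2.
exact: ler_wpM2r.
Qed.

End Contraction.

Section Consensus.
Context {R : realType} {m n : nat} (E : nat -> rel 'I_m) (A : nat -> 'M[R]_m).
Context (hG : weighted_graphs E A) (hA : network_assumption E A).
Context (x : 'I_m -> nat -> 'rV[R]_n).

Definition diam k : R := \big[Order.max/0]_(p : 'I_m * 'I_m) `|x p.1 k - x p.2 k|.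

(** The deviation from pure averaging, lumping together the subgradient step and the projection. *)
Definition perturbation k : R := \sum_i `|x i k.+1 - mix A x i k|.

Lemma diam_ge0 k : 0 <= diam k.
Proof. exact: bigmax_ge_id. Qed.

Lemma perturbation_ge0 k : 0 <= perturbation k.
Proof. exact: sumr_ge0. Qed.

Lemma dist_le_diam k i j : `|x i k - x j k| <= diam k.
Proof. exact: (le_bigmax _ _ (i, j)). Qed.

(** Averaging does not enlarge earlier errors, so the perturbations merely add up. *)
Lemma transition_error k s i :
  `|x i (k + s) - \sum_j transition A k s j i *: x j k|
    <= \sum_(r < s) perturbation (k + r).
Proof.
elim: s i => [|s IH] i.
  rewrite big_ord0 addn0 (bigD1 i) //= big1 => [|j ji].
    by rewrite mxE eqxx scale1r addr0 subrr normr0.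
  by rewrite mxE (negbTE ji) scale0r.
rewrite addnS big_ord_recr /= addrC.
have -> : \sum_j (transition A k s *m A (k + s)) j i *: x j k
  = \sum_l A (k + s)%N l i *: \sum_j transition A k s j l *: x j k.
  under [RHS]eq_bigr do rewrite scaler_sumr.
  rewrite exchange_big /=; apply: eq_bigr => j _.
  by rewrite mxE scaler_suml; apply: eq_bigr => l _; rewrite scalerA mulrC.
set y := \sum_l _.
have -> : x i (k + s).+1 - y
  = (x i (k + s).+1 - mix A x i (k + s)) + (mix A x i (k + s) - y).
  by rewrite addrA subrK.
rewrite (le_trans (ler_normD _ _)) // lerD //.
  by rewrite /perturbation (bigD1 i) //= lerDl sumr_ge0.
rewrite /mix /y -sumrB; under [X in `|X|]eq_bigr do rewrite -scalerBr.
apply: weighted_sum_le => [j||//]; first exact: (weight_ge0 hA).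
by have [_ _ ->] := network_stochastic hA (k + s).
Qed.

(** Two exact averages over the window contract by [weighted_sum_contract]; each iterate differs
    from its own by the accumulated perturbation, whence the factor 2. *)
Lemma diam_window : exists B eps, [/\ 0 < eps, eps <= 1 &
  forall k, diam (k + B) <= (1 - eps) * diam k
                            + 2 * \sum_(r < B) perturbation (k + r)].
Proof.
have [B [eps [e0 e1 he]]] := transition_lower_bound hG hA.
exists B, (eps ^+ 2); split.
- exact: exprn_gt0.
- by rewrite exprn_ile1 // ltW.
move=> k; have P0 : 0 <= \sum_(r < B) perturbation (k + r).
  by apply: sumr_ge0 => r _; apply: perturbation_ge0.
apply: bigmax_le => [|[i j] _ /=].
  rewrite addr_ge0 ?mulr_ge0 ?diam_ge0 // subr_ge0 exprn_ile1 //; exact: ltW.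
have hi := transition_error k B i; have hj := transition_error k B j.
have := weighted_sum_contract (i := i) (W := diam k) (u := fun l => x l k) (ltW e0)
  (fun l => transition_ge0 hA k B l i) (fun l => transition_ge0 hA k B l j)
  (he _ _ _) (he _ _ _) (transition_column_sum hA k B i)
  (transition_column_sum hA k B j) (dist_le_diam k).
move: hi hj; set u := \sum_j0 _ *: _; set v := \sum_j0 _ *: _ => hi hj huv.
have -> : x i (k + B) - x j (k + B)
  = (u - v) + ((x i (k + B) - u) - (x j (k + B) - v)).
  by rewrite !opprB; apply/rowP => l; rewrite !mxE; ring.
rewrite (le_trans (ler_normD _ _)) // lerD // (le_trans (ler_normB _ _)) //.
by rewrite mulr_natl mulr2n lerD.
Qed.

(** The window inequality is multiplied by [c (k + B)] and summed; monotonicity of [c] lets each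
    term on the right carry the weight of its own index. The share [1 - eps] of the sum is then
    absorbed on the left. *)
Lemma weighted_diam_sum (c : nat -> R) : (forall k, 0 <= c k) ->
  (forall k s, c (k + s)%N <= c k) ->
  exists C1 C2, [/\ 0 <= C1, 0 <= C2 & forall N,
    \sum_(k < N) c k * diam k <= C1 + C2 * \sum_(k < N) c k * perturbation k].
Proof.
move=> c0 cd; have [B [eps [e0 e1 hB]]] := diam_window.
pose T N := \sum_(k < N) c k * diam k.
pose U N := \sum_(k < N) c k * perturbation k.
have T0 N : 0 <= T N by apply: sumr_ge0 => k _; rewrite mulr_ge0 ?diam_ge0.
have U0 N : 0 <= U N by apply: sumr_ge0 => k _; rewrite mulr_ge0 ?perturbation_ge0.
have splitT (F : nat -> R) a b : \sum_(k < a + b) F k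
    = \sum_(k < a) F k + \sum_(k < b) F (a + k)%N.
  by rewrite big_split_ord.
exists (T B / eps), (2 * B%:R / eps); split; rewrite ?divr_ge0 ?mulr_ge0 ?(ltW e0) //.
move=> N; rewrite -/(T N) -/(U N).
suff H : eps * T N <= T B + 2 * B%:R * U N.
  by rewrite mulrAC -mulrDl ler_pdivlMr // mulrC.
have [NB|BN] := leqP N B.
  have TNB : T N <= T B.
    rewrite /T -(subnKC NB) (splitT (fun k => c k * diam k)) lerDl sumr_ge0 // => k _.
    by rewrite mulr_ge0 ?diam_ge0.
  apply: (@le_trans _ _ (T N)); first by rewrite ler_piMl.
  by rewrite (le_trans TNB) // lerDl !mulr_ge0.
have /subnKC Nd := ltnW BN; move: Nd; set N' := (N - B)%N => Nd.
have hT : T N = T B + \sum_(k < N') c (k + B)%N * diam (k + B).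
  rewrite -Nd /T (splitT (fun k => c k * diam k)); congr +%R.
  by apply: eq_bigr => k _; rewrite addnC.
have TN' : T N' <= T N.
  rewrite -Nd addnC /T (splitT (fun k => c k * diam k)) lerDl.
  by apply: sumr_ge0 => k _; rewrite mulr_ge0 ?diam_ge0.
(* A sum shifted by [r < B] stays below [N], so it is part of [U N]; the window thus contributes at
   most [B] copies of [U N]. *)
have hU (r : 'I_B) : \sum_(k < N') c (k + r)%N * perturbation (k + r) <= U N.
  have -> : U N = \sum_(k < r + N') c k * perturbation k
                  + \sum_(k < B - r) c (r + N' + k)%N * perturbation (r + N' + k).
    rewrite -(splitT (fun k => c k * perturbation k)) /U.
    by have -> : N = (r + N' + (B - r))%N by have := ltn_ord r; lia.
  rewrite (splitT (fun k => c k * perturbation k)) -addrA addrCA; under eq_bigr do rewrite addnC.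
  by rewrite lerDl addr_ge0 // sumr_ge0 // => k _; rewrite mulr_ge0 ?perturbation_ge0.
have : \sum_(k < N') c (k + B)%N * diam (k + B)
    <= (1 - eps) * T N' + 2 * (B%:R * U N).
  apply: (@le_trans _ _ (\sum_(k < N') ((1 - eps) * (c k * diam k)
      + 2 * \sum_(r < B) c (k + r)%N * perturbation (k + r)))).
    apply: ler_sum => k _.
    apply: (le_trans (ler_wpM2l (c0 _) (hB k))); rewrite mulrDr lerD //.
      by rewrite mulrCA ler_wpM2l ?subr_ge0 // ler_wpM2r ?diam_ge0.
    rewrite mulrCA ler_wpM2l // mulr_sumr ler_sum // => r _.
    rewrite ler_wpM2r ?perturbation_ge0 //.
    have -> : (k + B = k + r + (B - r))%N by have := ltn_ord r; lia.
    exact: cd.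
  rewrite big_split /= -!mulr_sumr lerD // ler_wpM2l // exchange_big /=.
  rewrite (le_trans (ler_sum _ (fun r _ => hU r))) //.
  by rewrite sumr_const card_ord -[leLHS]mulr_natl.
have : (1 - eps) * T N' <= (1 - eps) * T N by rewrite ler_wpM2l // subr_ge0.
by rewrite hT; lra.
Qed.

End Consensus.

(** * Near-feasible points *)

(** Makes constants uniform over the finitely many agents. *)
Lemma uniform_bound (R : realType) (m : nat) (P : 'I_m -> R -> Prop) :
  (forall i a b, a <= b -> P i a -> P i b) -> (forall i, exists a, P i a) ->
  exists2 a, 0 <= a & forall i, P i a.
Proof.
move=> Pmono /choice[h hP]; exists (\sum_i `|h i|); first exact: sumr_ge0.
move=> i; apply: Pmono (hP i); rewrite (le_trans (ler_norm _)) //.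
by rewrite (bigD1 i) //= lerDl sumr_ge0.
Qed.

(** The difference of the two sides is a weighted variance. *)
Lemma dotv_weighted_sum_le (R : realType) (m n : nat) (w : 'I_m -> R)
    (u : 'I_m -> 'rV[R]_n) :
  (forall j, 0 <= w j) -> \sum_j w j = 1 ->
  dotv (\sum_j w j *: u j) (\sum_j w j *: u j) <= \sum_j w j * dotv (u j) (u j).
Proof.
move=> w0 w1; set s := \sum_j w j *: u j.
have : 0 <= \sum_j w j * dotv (u j - s) (u j - s).
  by apply: sumr_ge0 => j _; rewrite mulr_ge0 ?dotv_ge0.
have -> : \sum_j w j * dotv (u j - s) (u j - s)
    = \sum_j w j * dotv (u j) (u j) - 2 * (\sum_j w j * dotv (u j) s)
      + (\sum_j w j) * dotv s s.
  rewrite mulr_sumr mulr_suml -sumrB -big_split; apply: eq_bigr => j _ /=.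
  by rewrite dotv_polar !(dotvNl, dotvNr); ring.
rewrite w1; under [X in 2 * X]eq_bigr do rewrite -dotvZl.
by rewrite -dotv_suml -/s; lra.
Qed.

Section ProblemBounds.
Context {R : realType} {m n : nat} (f : 'I_m -> 'rV[R]_n -> R).
Context (X : 'I_m -> set 'rV[R]_n) (hX : convex_problem f X).

Lemma constraints_bounded :
  exists2 M, 0 <= M & forall i y, X i y -> `|y| <= M.
Proof.
apply: (@uniform_bound _ _ (fun i M => forall y, X i y -> `|y| <= M)).
  by move=> i a b ab h y /h /le_trans; apply.
move=> i; have [M [_ hM]] := compact_bounded (constraint_compact hX (i := i)).
by exists (M + 1) => y Xy; apply: (hM (M + 1)) => //; rewrite ltrDl.
Qed.

Lemma costs_lipschitz r : exists2 K, 0 <= K & forall i x y,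
  `|x| <= r -> `|y| <= r -> `|f i x - f i y| <= K * `|x - y|.
Proof.
apply: (@uniform_bound _ _ (fun i K => forall x y,
  `|x| <= r -> `|y| <= r -> `|f i x - f i y| <= K * `|x - y|)).
  move=> i a b ab h x y xr yr; apply: (le_trans (h x y xr yr)).
  exact: ler_wpM2r.
by move=> i; have [K _ h] := convex_ball_lipschitz (cost_convex hX i) r; exists K.
Qed.

Lemma cost_subgradients_bounded r : exists2 G, 0 <= G & forall i x g,
  `|x| <= r -> subdifferential (f i) x g -> `|g| <= G.
Proof.
apply: (@uniform_bound _ _ (fun i G => forall x g,
  `|x| <= r -> subdifferential (f i) x g -> `|g| <= G)).
  move=> i a b ab h x g xr gx; exact: le_trans (h x g xr gx) ab.
by move=> i; have [K _ h] := subgradient_ball_bounded (cost_convex hX i) r; exists K.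
Qed.

Lemma agent_exists : exists i : 'I_m, True.
Proof. by have [L [[x [g [[i _ _] _ _]]] _]] := subgradients_bounded hX; exists i. Qed.

Lemma feasible_ball : exists a rho, 0 < rho /\
  forall y, `|y - a| <= rho -> feasible X y.
Proof.
have [a /nbhs_ballP[e /= e0 he]] := feasible_interior hX.
exists a, (e / 2); split; first exact: divr_gt0.
move=> y ya; apply: he; rewrite -ball_normE /= distrC (le_lt_trans ya) //.
by rewrite ltr_pdivrMr // ltr_pMr // ltr1n.
Qed.

(* The points [u i] are at distance at most W of [v]; moving [v] towards the
   centre of a ball contained in every constraint set by a fraction of order W
   makes it feasible. *)
Lemma near_feasible : exists2 C, 0 <= C & forall (u : 'I_m -> 'rV[R]_n) W,
  (forall i, X i (u i)) -> (forall i j, `|u i - u j| <= W) ->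
  exists2 y, feasible X y & forall i, `|u i - y| <= C * W.
Proof.
have [M M0 hM] := constraints_bounded; have [i0 _] := agent_exists.
have [a [rho [rho0 ha]]] := feasible_ball.
have fa : feasible X a by apply: ha; rewrite subrr normr0 ltW.
(* The 1 accounts for the distance from [u i] to [v], the rest for the displacement [t *: (v - a)],
   as [t <= W / rho]. *)
exists (1 + 2 * M / rho) => [|u W Xu uW].
  by rewrite addr_ge0 // divr_ge0 ?mulr_ge0 // ltW.
have W0 : 0 <= W by apply: le_trans (uW i0 i0).
pose v := u i0; pose t := W / (W + rho).
have Wr : 0 < W + rho by lra.
have t0 : 0 <= t by apply: divr_ge0 => //; lra.
have t1 : t <= 1 by rewrite ler_pdivrMr //; lra.
exists (t *: a + (1 - t) *: v); last first.
  move=> i.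
  have -> : u i - (t *: a + (1 - t) *: v) = (u i - v) + t *: (v - a).
    by apply/rowP => l; rewrite !mxE; ring.
  rewrite mulrDl mul1r (le_trans (ler_normD _ _)) // lerD ?uW // normrZ ger0_norm //.
  have va : `|v - a| <= 2 * M.
    have : `|v| <= M by apply: hM (Xu i0).
    have : `|a| <= M by apply: (hM i0); apply: fa.
    have := ler_normB v a; lra.
  rewrite mulrC mulrAC -mulrA; apply: ler_pM => //.
  by rewrite /t ler_wpM2l // lef_pV2 ?posrE //; lra.
move=> i _; have [W00|WN0] := eqVneq W 0.
  have /eqP : u i - v = 0 by apply/eqP; rewrite -normr_le0 -W00; exact: uW.
  rewrite subr_eq0 => /eqP uv; rewrite -uv.
  by apply: convex_setE (constraint_convex hX (i:=i)) _ _ (Xu i); rewrite ?t0 //; exact: fa.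
have Wp : 0 < W by rewrite lt_neqAle eq_sym WN0.
(* [t] is chosen so that [t * (rho / W) = 1 - t]. The first point is within [rho] of [a], hence
   feasible, and the second lies in [X i]. *)
have -> : t *: a + (1 - t) *: v
  = t *: (a + (rho / W) *: (v - u i)) + (1 - t) *: u i.
  apply/rowP => l; rewrite !mxE /t; field; rewrite WN0 gt_eqF //.
apply: convex_setE (constraint_convex hX (i:=i)) _ _ (Xu i); rewrite ?t0 //.
apply: (ha _ _ i) => //; rewrite addrAC subrr add0r normrZ ger0_norm; last first.
  by rewrite divr_ge0 // ltW.
by rewrite mulrAC ler_pdivrMr // ler_wpM2l ?(ltW rho0) //; exact: uW.
Qed.

(** Replacing every [u i] by the common feasible point [y] changes each cost by at most
    [K * (C * W)], and [xs] is optimal against [y]. *)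
Lemma objective_gap_ge (xs : 'rV[R]_n) :
  is_argmin (feasible X) (objective f) xs ->
  exists2 C, 0 <= C & forall (u : 'I_m -> 'rV[R]_n) W,
    (forall i, X i (u i)) -> (forall i j, `|u i - u j| <= W) ->
    - (C * W) <= \sum_i f i (u i) - objective f xs.
Proof.
move=> [_ minxs]; have [C C0 hC] := near_feasible.
have [M M0 hM] := constraints_bounded; have [K K0 hK] := costs_lipschitz M.
exists (m%:R * (K * C)) => [|u W Xu uW]; first by rewrite !mulr_ge0.
have [y fy uy] := hC u W Xu uW.
have h i : f i y - K * (C * W) <= f i (u i).
  have yM : `|y| <= M by apply: (hM i); apply: fy.
  have uM : `|u i| <= M by apply: (hM i); apply: Xu.
  have := hK i _ _ uM yM; rewrite ler_norml => /andP[h _].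
  have := ler_wpM2l K0 (uy i); lra.
have hs : \sum_i f i y - m%:R * (K * (C * W)) <= \sum_i f i (u i).
  have -> : m%:R * (K * (C * W)) = \sum_(i < m) K * (C * W).
    by rewrite sumr_const card_ord mulr_natl.
  by rewrite -sumrB; apply: ler_sum => i _; apply: h.
have := minxs y fy; rewrite /objective; lra.
Qed.

End ProblemBounds.

(** * The weighted sums *)

Section Iterates.
Context {R : realType} {m n : nat} (f : 'I_m -> 'rV[R]_n -> R).
Context (X : 'I_m -> set 'rV[R]_n) (E : nat -> rel 'I_m) (A : nat -> 'M[R]_m).
Context (c : nat -> R) (x g : 'I_m -> nat -> 'rV[R]_n) (xs : 'rV[R]_n).
Context (hX : convex_problem f X) (hG : weighted_graphs E A).
Context (hA : network_assumption E A) (c0 : forall k, 0 < c k).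
Context (hx : subgradient_averaging c f X A x g).
Context (hxs : is_argmin (feasible X) (objective f) xs).

(** Each cost is evaluated at its own agent's iterate, so the gap can be negative. *)
Definition gap k : R := \sum_i f i (x i k) - objective f xs.

Definition sq_dist k : R := \sum_i dotv (x i k - xs) (x i k - xs).

Definition sq_perturbation k : R := \sum_i `|x i k.+1 - mix A x i k| ^+ 2.

Lemma iterate_in i k : X i (x i k).
Proof. by case: k => [|k]; [exact: (iterate0 hx) | have [] := iterateS hx i k]. Qed.

Lemma weight_column_sum k i : \sum_j A k j i = 1.
Proof. by have [_ _] := network_stochastic hA k; apply. Qed.

Lemma weight_row_sum k j : \sum_i A k j i = 1.
Proof. by have [_ h _] := network_stochastic hA k. Qed.

Lemma dist_mix_iterate k i j : `|mix A x i k - x j k| <= diam x k.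
Proof.
rewrite /mix weighted_sumB ?weight_column_sum //.
apply: weighted_sum_le => [l||l]; last exact: dist_le_diam.
  exact: weight_ge0 hA _ _ _.
exact: weight_column_sum.
Qed.

Lemma dist_mix k i j : `|mix A x i k - mix A x j k| <= diam x k.
Proof.
rewrite {1}/mix weighted_sumB ?weight_column_sum //.
apply: weighted_sum_le => [l||l]; first exact: weight_ge0 hA _ _ _.
  exact: weight_column_sum.
by rewrite distrC; exact: dist_mix_iterate.
Qed.

Lemma sum_mix_swap k (F : 'I_m -> R) : \sum_i \sum_j A k j i * F j = \sum_j F j.
Proof.
rewrite exchange_big; apply: eq_bigr => j _ /=.
by rewrite -mulr_suml weight_row_sum mul1r.
Qed.

(** Column sums give Jensen's inequality for each agent; row sums then restore the total over
    agents. *)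
Lemma sq_dist_mix_le k :
  \sum_i dotv (mix A x i k - xs) (mix A x i k - xs) <= sq_dist k.
Proof.
rewrite /sq_dist -(sum_mix_swap k (fun j => dotv (x j k - xs) (x j k - xs))); apply: ler_sum => i _.
rewrite /mix weighted_sumB ?weight_column_sum //.
apply: dotv_weighted_sum_le => [l|]; first exact: weight_ge0 hA _ _ _.
exact: weight_column_sum.
Qed.

(** The proximal inequality at [xs] is summed over agents, with x_i(k+1) - xs split at z_i(k): the
    first part costs a perturbation, the second is compared with the gap. *)
Lemma one_step : exists C D, [/\ 0 <= C, 0 <= D & forall k,
  sq_dist k.+1 + sq_perturbation k + 2 * c k * gap k
    <= sq_dist k + 2 * c k * (C * diam x k + D * perturbation A x k)].
Proof.
have [M M0 hM] := constraints_bounded hX.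
have [K K0 hK] := costs_lipschitz hX M.
have [G G0 hGr] := cost_subgradients_bounded hX M.
exists (m%:R * (K + n%:R * G)), (n%:R * G); split; rewrite ?mulr_ge0 ?addr_ge0 ?mulr_ge0 //.
move=> k; pose z i := mix A x i k; pose d i := mix A g i k.
have xM i : `|x i k| <= M by apply: hM (iterate_in i k).
(* z_i need not lie in any constraint set, but as a convex combination it stays in the ball of
   radius [M], where the Lipschitz and subgradient bounds apply. *)
have zM i : `|z i| <= M.
  by apply: weighted_sum_le => //[j|]; [exact: weight_ge0 hA _ _ _ | exact: weight_column_sum].
have gG i : `|g i k| <= G by apply: hGr (zM i) (subgradient_pick hx i k).
have dG i : `|d i| <= G.
  by apply: weighted_sum_le => //[j|]; [exact: weight_ge0 hA _ _ _ | exact: weight_column_sum].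
have fxs : feasible X xs by case: hxs.
have prox i := proximal_step_le (c0 k) (constraint_convex hX (i:=i))
  (iterateS hx i k) (fxs i I).
have dp i : - (n%:R * G * `|x i k.+1 - z i|) <= dotv (d i) (x i k.+1 - z i).
  have := normr_dotv (d i) (x i k.+1 - z i); rewrite ler_norml => /andP[+ _].
  apply: le_trans; rewrite lerN2 -!mulrA ler_wpM2l // ler_wpM2r //.
(* The subgradient [g j k] belongs to z_j, not z_i. Passing from z_i to z_j costs [n%:R * G]
   diameters, and from z_j to x_j another [K]. *)
have dz i : \sum_j A k j i * (f j (x j k) - f j xs - (K + n%:R * G) * diam x k)
    <= dotv (d i) (z i - xs).
  rewrite /d /mix dotv_suml; apply: ler_sum => j _; rewrite dotvZl.
  apply: ler_wpM2l; first exact: weight_ge0 hA _ _ _.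
  have -> : z i - xs = (z i - z j) - (xs - z j) by rewrite opprB addrA subrK.
  rewrite dotvDr dotvNr; have := subgradient_pick hx j k xs; rewrite -/(z j).
  have := hK j _ _ (xM j) (zM j); rewrite ler_norml => /andP[_ h1] h2.
  have h3 : K * `|x j k - z j| <= K * diam x k.
    by rewrite ler_wpM2l // distrC; exact: dist_mix_iterate.
  have := normr_dotv (g j k) (z i - z j); rewrite ler_norml => /andP[h4 _].
  have h5 : n%:R * `|g j k| * `|z i - z j| <= n%:R * G * diam x k.
    by rewrite ler_pM ?mulr_ge0 ?ler_wpM2l //; exact: dist_mix.
  lra.
have dzs : gap k - m%:R * (K + n%:R * G) * diam x k <= \sum_i dotv (d i) (z i - xs).
  apply: le_trans (ler_sum _ (fun i _ => dz i)).
  rewrite sum_mix_swap !sumrB /gap /objective sumr_const card_ord.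
  by rewrite -[X in _ <= _ - X]mulr_natl mulrA.
have dps : - (n%:R * G * perturbation A x k) <= \sum_i dotv (d i) (x i k.+1 - z i).
  rewrite /perturbation mulr_sumr -sumrN; apply: ler_sum => i _; exact: dp.
have total : sq_dist k.+1 + sq_perturbation k
    + 2 * c k * (\sum_i dotv (d i) (x i k.+1 - z i) + \sum_i dotv (d i) (z i - xs))
    <= \sum_i dotv (z i - xs) (z i - xs).
  rewrite /sq_dist /sq_perturbation -!big_split mulr_sumr -big_split /=; apply: ler_sum => i _.
  apply: le_trans (prox i); rewrite -dotvDr -/(z i) addrA subrK lerD2r lerD2l.
  exact: sqr_norm_le_dotv.
have := sq_dist_mix_le k; rewrite -/z.
have c2 : 0 <= 2 * c k by rewrite mulr_ge0 // ltW.
have := ler_wpM2l c2 (lerD dps dzs).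
lra.
Qed.

Lemma sq_dist_ge0 k : 0 <= sq_dist k.
Proof. by apply: sumr_ge0 => i _; exact: dotv_ge0. Qed.

Lemma sq_perturbation_ge0 k : 0 <= sq_perturbation k.
Proof. by apply: sumr_ge0 => i _; exact: sqr_ge0. Qed.

(** Young's inequality; [a] stays free because [weighted_sums] uses two values. *)
Lemma step_perturbation_le a k :
  2 * a * perturbation A x k <= sq_perturbation k + m%:R * a ^+ 2.
Proof.
have -> : m%:R * a ^+ 2 = \sum_(i < m) a ^+ 2.
  by rewrite sumr_const card_ord mulr_natl.
rewrite mulr_sumr -big_split; apply: ler_sum => i _ /=.
have := sqr_ge0 (`|x i k.+1 - mix A x i k| - a); rewrite sqrrB; lra.
Qed.

Context (cd : forall k s, c (k + s)%N <= c k).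

Lemma weighted_sums : exists a b, [/\ 0 <= a, 0 <= b & forall N,
  \sum_(k < N) c k * diam x k <= a + b * \sum_(k < N) c k ^+ 2 /\
  \sum_(k < N) c k * gap k <= a + b * \sum_(k < N) c k ^+ 2].
Proof.
have [C [D [C0 D0 hstep]]] := one_step.
have [H H0 hgap] := objective_gap_ge hX hxs.
have c00 k : 0 <= c k by exact: ltW.
have [C1 [C2 [C10 C20 hdiam]]] := weighted_diam_sum hG hA x c00 cd.
have V0 := sq_dist_ge0 0; have m0 : 0 <= m%:R :> R by [].
pose beta := (C + H) * C2 + D.
have beta0 : 0 <= beta by rewrite !(addr_ge0, mulr_ge0).
pose p0 := sq_dist 0 + 2 * ((C + H) * C1).
have p00 : 0 <= p0 by rewrite !(addr_ge0, mulr_ge0).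
pose p1 := 2 * m%:R * beta ^+ 2 + m%:R / 2.
have p10 : 0 <= p1 by rewrite !(addr_ge0, divr_ge0, mulr_ge0, exprn_ge0).
(* The bounds for the diameters and for the gaps are added, so that one pair serves both. *)
exists (C1 + C2 * p0 + (sq_dist 0 + C * (C1 + C2 * p0) + D * p0)),
  (C2 * p1 + (C * (C2 * p1) + D * p1)).
split; rewrite ?(addr_ge0, mulr_ge0) //.
move=> N; pose Q := \sum_(k < N) c k ^+ 2; rewrite -/Q.
pose T := \sum_(k < N) c k * diam x k; rewrite -/T.
pose P := \sum_(k < N) c k * perturbation A x k.
pose S2 := \sum_(k < N) sq_perturbation k.
pose Ga := \sum_(k < N) c k * gap k; rewrite -/Ga.
have Q0 : 0 <= Q by apply: sumr_ge0 => k _; exact: sqr_ge0.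
have S20 : 0 <= S2 by apply: sumr_ge0 => k _; exact: sq_perturbation_ge0.
have hT : T <= C1 + C2 * P by exact: hdiam.
have hsum : sq_dist N + S2 + 2 * Ga <= sq_dist 0 + 2 * (C * T + D * P).
  rewrite /S2 /Ga /T /P; elim: (N) => [|N' IH].
    by rewrite !big_ord0; lra.
  by rewrite !big_ord_recr /=; have := hstep N'; lra.
have hGa : - (H * T) <= Ga.
  rewrite mulr_sumr -sumrN; apply: ler_sum => k _.
  rewrite mulrCA -mulrN ler_wpM2l //; apply: hgap => [i|i j].
    exact: iterate_in.
  exact: dist_le_diam.
have hP a : 2 * a * P <= S2 + m%:R * a ^+ 2 * Q.
  rewrite !mulr_sumr -big_split; apply: ler_sum => k _ /=.
  by have := step_perturbation_le (a * c k) k; rewrite exprMn; lra.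
have VN := sq_dist_ge0 N.
have hCH : (C + H) * T <= (C + H) * (C1 + C2 * P) by rewrite ler_wpM2l ?addr_ge0.
have hS2 : S2 <= p0 + 2 * beta * P by rewrite /p0 /beta; lra.
(* The choice [2 * beta] lets half of [S2] absorb the term [2 * beta * P] of [hS2], giving
   [S2 <= 2 * p0 + 4 * m%:R * beta ^+ 2 * Q]; the choice 1 then bounds [P]. *)
have hPQ : P <= p0 + p1 * Q.
  by have := hP (2 * beta); have := hP 1; rewrite /p1; lra.
have hTQ : T <= C1 + C2 * p0 + C2 * p1 * Q.
  by have := ler_wpM2l C20 hPQ; lra.
have hGQ : Ga <= sq_dist 0 + C * (C1 + C2 * p0) + D * p0
                 + (C * (C2 * p1) + D * p1) * Q.
  by have := ler_wpM2l C0 hTQ; have := ler_wpM2l D0 hPQ; lra.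
have e1 : 0 <= sq_dist 0 + C * (C1 + C2 * p0) + D * p0.
  by rewrite !(addr_ge0, mulr_ge0).
have e2 : 0 <= (C * (C2 * p1) + D * p1) * Q by rewrite !(addr_ge0, mulr_ge0).
have e3 : 0 <= C1 + C2 * p0 by rewrite !(addr_ge0, mulr_ge0).
have e4 : 0 <= C2 * p1 * Q by rewrite !(addr_ge0, mulr_ge0).
by split; lra.
Qed.

End Iterates.

(** * Running averages and rates *)

Section RunningAverage.
Context {R : realType} {n : nat} (c : nat -> R) (c0 : forall k, 0 < c k).
Implicit Types (u v : nat -> 'rV[R]_n) (k : nat).

Lemma step_sum0 : step_sum c 0 = 0.
Proof. by rewrite /step_sum big_geq. Qed.

Lemma step_sumS k : step_sum c k.+1 = step_sum c k + c k.+1.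
Proof. by rewrite /step_sum big_nat_recr. Qed.

Lemma step_sum_ge0 k : 0 <= step_sum c k.
Proof. by apply: sumr_ge0 => r _; exact: ltW. Qed.

Lemma step_sum_gt0 k : 0 < step_sum c k.+1.
Proof. by rewrite step_sumS ltr_wpDl ?step_sum_ge0. Qed.

Lemma step_ratio k : 0 <= c k.+1 / step_sum c k.+1 <= 1.
Proof.
rewrite divr_ge0 ?step_sum_ge0 ?(ltW (c0 _)) // ler_pdivrMr ?step_sum_gt0 //.
by rewrite mul1r step_sumS lerDr step_sum_ge0.
Qed.

(** The convex-combination form drives the inductions below. At [k = 0] the weight [t] is 1, so
    [u 0] drops out. *)
Lemma running_averageS u k (t := c k.+1 / step_sum c k.+1) :
  running_average c u k.+1 = t *: u k.+1 + (1 - t) *: running_average c u k.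
Proof.
rewrite /= scalerDr !scalerA; congr (_ *: _ + _ *: _); first by rewrite mulrC.
have S0 := step_sum_gt0 k; rewrite /t [in RHS]step_sumS in S0 *.
by rewrite step_sumS in S0 *; field; rewrite gt_eqF.
Qed.

Lemma running_average_in (D : set 'rV[R]_n) u k :
  convex_set (D : set (convex_lmodType 'rV[R]_n)) -> (forall k, D (u k)) ->
  D (running_average c u k).
Proof.
move=> cD Du; elim: k => [|k IH]; first exact: Du.
by rewrite running_averageS; apply: convex_setE (step_ratio k) (Du _) IH.
Qed.

Lemma mul_step_ratio k (t := c k.+1 / step_sum c k.+1) a b :
  step_sum c k.+1 * (t * a + (1 - t) * b) = c k.+1 * a + step_sum c k * b.
Proof.
have /lt0r_neq0 S0 := step_sum_gt0 k; rewrite /t step_sumS in S0 *.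
by field.
Qed.

Lemma running_average_dist u v k :
  step_sum c k * `|running_average c u k - running_average c v k|
    <= \sum_(1 <= r < k.+1) c r * `|u r - v r|.
Proof.
elim: k => [|k IH]; first by rewrite step_sum0 mul0r big_geq.
have /andP[t0 t1] := step_ratio k.
rewrite big_nat_recr // [leRHS]addrC !running_averageS.
set t := c k.+1 / _ in t0 t1 *.
apply: (@le_trans _ _ (step_sum c k.+1 * (t * `|u k.+1 - v k.+1|
   + (1 - t) * `|running_average c u k - running_average c v k|))).
  rewrite ler_wpM2l ?step_sum_ge0 // opprD addrACA -!scalerBr.
  rewrite (le_trans (ler_normD _ _)) // (normrZ t) (normrZ (1 - t)) (ger0_norm t0).
  by rewrite (@ger0_norm _ (1 - t)) ?subr_ge0.
by rewrite mul_step_ratio lerD2l.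
Qed.

Lemma running_average_jensen (f : 'rV[R]_n -> R) u k :
  convex_function ([set: 'rV[R]_n] : set (convex_lmodType 'rV[R]_n)) f ->
  step_sum c k * f (running_average c u k) <= \sum_(1 <= r < k.+1) c r * f (u r).
Proof.
move=> cf; elim: k => [|k IH]; first by rewrite step_sum0 mul0r big_geq.
rewrite running_averageS big_nat_recr // [leRHS]addrC.
have h := convex_functionE (u k.+1) (running_average c u k) cf (step_ratio k).
apply: (le_trans (ler_wpM2l (step_sum_ge0 k.+1) h)).
by rewrite mul_step_ratio lerD2l.
Qed.

End RunningAverage.

(** * Sums of the square-root step size and logarithmic rates *)

Section SqrtStep.
Context {R : realType} (theta : R) (theta0 : 0 < theta).

Lemma sqrt_step_gt0 k : 0 < sqrt_step theta k.
Proof. by rewrite divr_gt0 // sqrtr_gt0. Qed.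

Lemma sqrt_step_decr k s : sqrt_step theta (k + s) <= sqrt_step theta k.
Proof.
by rewrite ler_pM2l // lef_pV2 ?posrE ?sqrtr_gt0 // ler_wsqrtr // ler_nat ltnS leq_addr.
Qed.

Lemma ln_nat_ge0 k : 0 <= ln (k%:R : R).
Proof. by case: k => [|k]; [rewrite ln0 | rewrite ln_ge0 // ler1n]. Qed.

Lemma harmonic_sum_le k : (0 < k)%N ->
  \sum_(r < k) (r.+1%:R : R)^-1 <= 1 + ln k%:R.
Proof.
case: k => // k _; elim: k => [|k IH].
  by rewrite big_ord_recl big_ord0 invr1 ln1.
rewrite big_ord_recr /=.
have k2 : 0 < k.+2%:R :> R by [].
have k1 : 0 < k.+1%:R :> R by [].
(* The increment of the logarithm dominates the new harmonic term, by ln(1 + y) <= y at y =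
   -1/(k+2). *)
have : ln (k.+1%:R / k.+2%:R : R) <= - k.+2%:R^-1.
  have -> : k.+1%:R / k.+2%:R = 1 + - k.+2%:R^-1 :> R.
    by rewrite -[k.+1%:R](addrK 1) natr1 mulrBl divff ?gt_eqF // mul1r.
  by apply: le_ln1Dx; rewrite ltrN2 invf_lt1 // ltr1n.
rewrite ln_div ?posrE //; move: (k.+2%:R^-1) (ln k.+1%:R) (ln k.+2%:R) IH => a b d; lra.
Qed.

Lemma sqrt_step_sq_sum k : (0 < k)%N ->
  \sum_(r < k.+1) sqrt_step theta r ^+ 2 <= theta ^+ 2 * (2 + ln k%:R).
Proof.
move=> k0.
have -> : \sum_(r < k.+1) sqrt_step theta r ^+ 2
    = theta ^+ 2 * \sum_(r < k.+1) (r.+1%:R : R)^-1.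
  rewrite mulr_sumr; apply: eq_bigr => r _.
  by rewrite exprMn exprVn sqr_sqrtr.
(* The last of the [k.+1] terms is bounded by 1, so that the logarithm is taken at [k]. *)
rewrite ler_wpM2l ?sqr_ge0 // big_ord_recr /=.
apply: (@le_trans _ _ (1 + ln k%:R + 1)); last lra.
by rewrite lerD ?harmonic_sum_le // invf_le1 // ler1n.
Qed.

Lemma sqrt_step_sum_ge k : theta / 2 * Num.sqrt k%:R <= step_sum (sqrt_step theta) k.
Proof.
case: k => [|k]; first by rewrite sqrtr0 mulr0 step_sum0.
(* Every term is at least the last one; the factor 1/2 comes from k + 2 <= 4 (k + 1). *)
apply: (@le_trans _ _ (\sum_(1 <= r < k.+2) sqrt_step theta k.+1)).
  rewrite sumr_const_nat subSS subn0 -[leRHS]mulr_natr /sqrt_step -!mulrA.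
  rewrite ler_pM2l // mulrC [leRHS]mulrC.
  set s := Num.sqrt k.+2%:R; set q := Num.sqrt k.+1%:R.
  have s0 : 0 < s by rewrite sqrtr_gt0.
  have q0 : 0 < q by rewrite sqrtr_gt0.
  have -> : k.+1%:R = q ^+ 2 :> R by rewrite sqr_sqrtr.
  rewrite ler_pdivlMr // mulrAC ler_pdivrMr // expr2 -mulrA ler_pM2l //.
  rewrite -(@ler_pXn2r _ 2) ?nnegrE ?mulr_ge0 ?(ltW q0) ?(ltW s0) // exprMn !sqr_sqrtr //.
  rewrite -natrX -natrM ler_nat; lia.
rewrite /step_sum !big_nat; apply: ler_sum => r /andP[_ rk].
by rewrite -(subnKC (rk : (r <= k.+1)%N)); exact: sqrt_step_decr.
Qed.

Lemma ln_le_root4 k : (0 < k)%N -> ln (k%:R : R) <= 4 * Num.sqrt (Num.sqrt k%:R).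
Proof.
move=> k0; set q := Num.sqrt _.
have q0 : 0 < q by rewrite !sqrtr_gt0 ltr0n.
have -> : k%:R = q ^+ 4 :> R.
  by rewrite (exprM q 2 2) sqr_sqrtr ?sqrtr_ge0 // sqr_sqrtr.
by rewrite lnXn // -[leLHS]mulr_natl ler_wpM2l // ltW // ln_sublinear.
Qed.

(** Since ln k is at most four times the fourth root of k, the bound decays like the inverse fourth
    root. *)
Lemma log_rate_cvg0 (a b : R) (h : nat -> R) : 0 <= a -> 0 <= b ->
  (forall k, (0 < k)%N -> `|h k| <= (a + b * ln k%:R) / Num.sqrt k%:R) ->
  h @ \oo --> 0.
Proof.
move=> a0 b0 hh; pose C := a + 4 * b + 1.
have C0 : 0 < C by rewrite ltr_wpDl // addr_ge0 // mulr_ge0.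
have bound k : (0 < k)%N -> `|h k| <= C / Num.sqrt (Num.sqrt k%:R).
  move=> k0; apply: (le_trans (hh k k0)); set q := Num.sqrt (Num.sqrt _).
  have q0 : 0 < q by rewrite !sqrtr_gt0 ltr0n.
  have q1 : 1 <= q by rewrite -[leLHS]sqrtr1 ler_wsqrtr // -[leLHS]sqrtr1 ler_wsqrtr // ler1n.
  have -> : Num.sqrt k%:R = q ^+ 2 :> R by rewrite sqr_sqrtr ?sqrtr_ge0.
  rewrite ler_pdivrMr ?exprn_gt0 // expr2 mulrA divfK ?gt_eqF //.
  have := ler_wpM2l b0 (ln_le_root4 k0); rewrite -/q.
  have := ler_wpM2l a0 q1; rewrite /C; lra.
apply/cvgr0Pnorm_lt => e e0.
near=> k.
have k0 : (0 < k)%N by near: k; exists 1%N.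
apply: (le_lt_trans (bound k k0)).
have q0 : 0 < Num.sqrt (Num.sqrt k%:R) :> R by rewrite !sqrtr_gt0 ltr0n.
rewrite ltr_pdivrMr // -ltr_pdivrMl //.
rewrite -(@ltr_pXn2r _ 4) ?nnegrE ?mulr_ge0 ?invr_ge0 ?ltW //.
rewrite (exprM (Num.sqrt _) 2 2) sqr_sqrtr ?sqrtr_ge0 // sqr_sqrtr //.
by near: k; exact: nbhs_infty_gtr.
Unshelve. all: by end_near.
Qed.

End SqrtStep.

(** Jensen's inequality bounds the error from above. From below, [objective_gap_ge] applies to the
    averages themselves, which lie in their own sets at mutual distance at most
    [W / step_sum c k]. *)
Lemma average_bounds (R : realType) (m n : nat)
    (f : 'I_m -> 'rV[R]_n -> R) (X : 'I_m -> set 'rV[R]_n)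
    (E : nat -> rel 'I_m) (A : nat -> 'M[R]_m) (c : nat -> R)
    (x g : 'I_m -> nat -> 'rV[R]_n) (xs : 'rV[R]_n) :
  convex_problem f X -> weighted_graphs E A -> network_assumption E A ->
  (forall k, 0 < c k) -> (forall k s, c (k + s)%N <= c k) ->
  subgradient_averaging c f X A x g ->
  is_argmin (feasible X) (objective f) xs ->
  let xhat i := running_average c (x i) in
  exists a b, [/\ 0 <= a, 0 <= b & forall k,
    (forall i j, step_sum c k * `|xhat i k - xhat j k|
                 <= a + b * \sum_(r < k.+1) c r ^+ 2) /\
    step_sum c k * `|\sum_i f i (xhat i k) - objective f xs|
      <= a + b * \sum_(r < k.+1) c r ^+ 2].
Proof.
move=> hX hG hA c0 cd hx hxs xhat.
have [a [b [a0 b0 hab]]] := weighted_sums hX hG hA c0 hx hxs cd.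
have [H H0 hgap] := objective_gap_ge hX hxs.
(* The averages start at index 1 but [weighted_sums] at index 0. The dropped diameter term is
   nonnegative; the dropped gap term may not be, and [d] compensates for it. *)
pose d := `|c 0%N * gap f x xs 0|; have d0 : 0 <= d by exact: normr_ge0.
exists ((1 + H) * (a + d)), ((1 + H) * b).
split; rewrite ?mulr_ge0 ?addr_ge0 // => k.
pose Q := \sum_(r < k.+1) c r ^+ 2; rewrite -/Q.
have Q0 : 0 <= Q by apply: sumr_ge0 => r _; exact: sqr_ge0.
have S0 := step_sum_ge0 c0 k.
pose W := \sum_(1 <= r < k.+1) c r * diam x r.
have hT : W <= a + b * Q.
  apply: le_trans (proj1 (hab k.+1)).
  rewrite big_ord_recl /W big_add1 big_mkord /=.
  by rewrite lerDr mulr_ge0 ?diam_ge0 ?(ltW (c0 _)).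
have hGa : \sum_(1 <= r < k.+1) c r * gap f x xs r <= a + d + b * Q.
  have := proj2 (hab k.+1); rewrite big_ord_recl big_add1 big_mkord /=.
  by have := ler_norm (- (c 0%N * gap f x xs 0)); rewrite normrN -/d -/Q; lra.
have hdist i j : step_sum c k * `|xhat i k - xhat j k| <= W.
  apply: (le_trans (running_average_dist c0 _ _ _)).
  apply: ler_sum => r _; rewrite ler_wpM2l ?(ltW (c0 _)) //; exact: dist_le_diam.
have bQ : 0 <= b * Q by rewrite mulr_ge0.
have HaQ : 0 <= H * (a + d + b * Q) by rewrite !(mulr_ge0, addr_ge0).
split=> [i j|]; first by have := hdist i j; lra.
have up : step_sum c k * (\sum_i f i (xhat i k) - objective f xs)
    <= \sum_(1 <= r < k.+1) c r * gap f x xs r.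
  under [leRHS]eq_bigr do rewrite /gap mulrBr.
  rewrite sumrB -mulr_suml mulrBr lerB // mulr_sumr.
  under [leRHS]eq_bigr do rewrite mulr_sumr.
  rewrite exchange_big /=; apply: ler_sum => i _.
  exact: running_average_jensen (cost_convex hX i).
have low : - (H * W) <= step_sum c k * (\sum_i f i (xhat i k) - objective f xs).
  case: k => [|k] in Q Q0 S0 W hT hGa hdist bQ HaQ up *.
    rewrite step_sum0 mul0r oppr_le0 mulr_ge0 // /W big_geq //.
  have Sp := step_sum_gt0 c0 k.
  rewrite [leRHS]mulrC -ler_pdivrMr // mulNr -mulrA; apply: hgap => [i|i j].
    apply: running_average_in => // [|r]; last exact: iterate_in hx i r.
    exact: (constraint_convex hX (i:=i)).
  by rewrite ler_pdivlMr // mulrC; exact: hdist.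
have hW : H * W <= H * (a + b * Q) by rewrite ler_wpM2l.
have Hd : 0 <= H * d by rewrite mulr_ge0.
rewrite -[X in X * `|_|](ger0_norm S0) -normrM ler_norml; apply/andP; split; lra.
Qed.

(** Near a cluster point of [u] there are points [u k] with [v k] arbitrarily close to them, so the
    cluster point is adherent to [D]. *)
Lemma cluster_subset_closed (R : realType) (V : normedModType R) (u v : nat -> V)
    (D : set V) :
  closed D -> (forall k, D (v k)) -> (fun k => `|u k - v k|) @ \oo --> (0 : R) ->
  cluster (u @ \oo) `<=` D.
Proof.
move=> cD Dv uv p hp; apply: cD => B /nbhs_ballP[e /= e0 pB].
have e2 : 0 < e / 2 by rewrite divr_gt0.
have /cvgr0Pnorm_lt/(_ _ e2) near_uv := uv.
have hA : (u @ \oo) [set y | exists2 k, y = u k & `|u k - v k| < e / 2].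
  by apply: filterS near_uv => k /=; rewrite normr_id => h; exists k.
have [_ [[k -> ukv] puk]] := hp _ _ hA (nbhsx_ballx p _ e2).
exists (v k); split=> //; apply: pB.
move: puk; rewrite -ball_normE /= => puk.
have -> : p - v k = (p - u k) + (u k - v k) by rewrite addrA subrK.
by rewrite (le_lt_trans (ler_normD _ _)) // [e]splitr ltrD.
Qed.

Theorem theorem2 (R : realType) (m n : nat)
    (f : 'I_m -> 'rV[R]_n -> R) (X : 'I_m -> set 'rV[R]_n)
    (E : nat -> rel 'I_m) (A : nat -> 'M[R]_m)
    (theta : R) (x g : 'I_m -> nat -> 'rV[R]_n) (xstar : 'rV[R]_n)
    (hA1 : convex_problem f X)
    (hG : weighted_graphs E A)
    (hA2 : network_assumption E A)
    (htheta : 0 < theta)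
    (hx : subgradient_averaging (sqrt_step theta) f X A x g)
    (hxstar : is_argmin (feasible X) (objective f) xstar) :
  let xhat := fun i : 'I_m => running_average (sqrt_step theta) (x i) in
  [/\ forall i j : 'I_m,
        ((fun k : nat => norm2 (xhat i k - xhat j k)) @ \oo --> (0 : R)) /\
        ((fun k : nat => norm2 (xhat i k - xhat j k) : R^o)
          =O_\oo (fun k : nat => ln (k%:R : R) / Num.sqrt k%:R : R^o)),
      forall i : 'I_m, cluster (xhat i @ \oo) `<=` feasible X
    & exists B1 B2 : R, [/\ 0 < B1, 0 < B2 &
        forall k : nat, (1 <= k)%N ->
          `|(\sum_(i < m) f i (xhat i k)) - objective f xstar|
            <= B1 * (1 / Num.sqrt k%:R) + B2 * (ln k%:R / Num.sqrt k%:R)]].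
Proof.
move=> xhat.
have c0 := sqrt_step_gt0 htheta.
have [a [b [a0 b0 hab]]] := average_bounds hA1 hG hA2 c0
  (sqrt_step_decr htheta) hx hxstar.
(* These come from dividing [a + b * theta ^+ 2 * (2 + ln k%:R)] by [theta / 2 * Num.sqrt k%:R]; the
   added 1 makes them positive. *)
pose B1 := 2 / theta * (a + 2 * b * theta ^+ 2) + 1.
pose B2 := 2 / theta * (b * theta ^+ 2) + 1.
have B10 : 0 < B1.
  by rewrite ltr_wpDl // !(mulr_ge0, addr_ge0, invr_ge0, exprn_ge0) ?(ltW htheta).
have B20 : 0 < B2.
  by rewrite ltr_wpDl // !(mulr_ge0, addr_ge0, invr_ge0, exprn_ge0) ?(ltW htheta).
have rate k (r : R) : (0 < k)%N -> 0 <= r ->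
    step_sum (sqrt_step theta) k * r
      <= a + b * \sum_(r < k.+1) sqrt_step theta r ^+ 2 ->
    r <= (B1 + B2 * ln k%:R) / Num.sqrt k%:R.
  move=> k0 r0 hr; have q0 : 0 < Num.sqrt (k%:R : R) by rewrite sqrtr_gt0 ltr0n.
  rewrite ler_pdivlMr //.
  have h1 := ler_wpM2r r0 (sqrt_step_sum_ge htheta k).
  have h2 := ler_wpM2l b0 (sqrt_step_sq_sum theta k0).
  have l0 := @ln_nat_ge0 R k.
  have -> : r * Num.sqrt k%:R = 2 / theta * (theta / 2 * Num.sqrt k%:R * r).
    by field; rewrite gt_eqF.
  apply: (@le_trans _ _ (2 / theta * (a + b * (theta ^+ 2 * (2 + ln k%:R))))).
    by rewrite ler_wpM2l ?divr_ge0 ?(ltW htheta) //; lra.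
  by rewrite /B1 /B2; lra.
have dist_rate i j k : (0 < k)%N ->
    `|xhat i k - xhat j k| <= (B1 + B2 * ln k%:R) / Num.sqrt k%:R.
  by move=> k0; apply: rate => //; have [h _] := hab k; exact: h.
have norm2_rate i j k : (0 < k)%N -> `|norm2 (xhat i k - xhat j k)|
    <= (n%:R * B1 + n%:R * B2 * ln k%:R) / Num.sqrt k%:R.
  move=> k0; rewrite ger0_norm ?sqrtr_ge0 // (le_trans (norm2_le _)) //.
  by rewrite -mulrA -mulrDr -mulrA ler_wpM2l // dist_rate.
split.
- move=> i j; split.
    by apply: log_rate_cvg0 (norm2_rate i j); rewrite mulr_ge0 ?(ltW B10) ?(ltW B20).
  have ln20 : 0 < ln (2 : R) by rewrite ln_gt0 // ltr1n.
  (* From [k = 2] on, [ln k%:R >= ln 2] absorbs the term without logarithm. *)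
  apply/eqO_exP; exists (n%:R * B1 / ln 2 + n%:R * B2 + 1).
    by rewrite ltr_wpDl // addr_ge0 ?divr_ge0 ?mulr_ge0 ?(ltW B10) ?(ltW B20) ?(ltW ln20).
  exists 2%N => // k /= k2.
  have k0 : (0 < k)%N by apply: leq_trans k2.
  apply: (le_trans (norm2_rate i j k k0)).
  have lnk : ln (2 : R) <= ln k%:R by rewrite ler_ln ?posrE ?ltr0n // ler_nat.
  rewrite [X in _ <= _ * X]ger0_norm ?divr_ge0 ?sqrtr_ge0 ?ln_nat_ge0 //.
  rewrite mulrA ler_wpM2r ?invr_ge0 ?sqrtr_ge0 // -addrA mulrDl.
  rewrite lerD //.
    rewrite -[leRHS]mulrA ler_peMr ?mulr_ge0 ?(ltW B10) // mulrC ler_pdivlMr // mul1r //.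
  by rewrite mulrDl mul1r lerDl ln_nat_ge0.
(* For each [j], the average of agent [j] stays in the closed set [X j], and that of agent [i]
   approaches it. *)
- move=> i p hp j _; have xhatj k : X j (xhat j k).
    apply: running_average_in => // [|r]; first exact: (constraint_convex hA1 (i:=j)).
    exact: iterate_in hx j r.
  apply: cluster_subset_closed (xhatj) _ _ hp.
    exact: compact_closed (constraint_compact hA1 (i:=j)).
  apply: log_rate_cvg0 (ltW B10) (ltW B20) _ => k k0.
  by rewrite normr_id; exact: dist_rate.
- exists B1, B2; split=> // k k1; rewrite !mulrA mulr1 -mulrDl.
  by apply: rate => //; have [_] := hab k.
Qed.
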